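(* Let $q\geq 5$ be an odd prime power and let $\mathcal C$ be an irreducible conic of $\mathrm{PG}(2,q^2)$ having at least one point in $\mathrm{PG}(2,q)$. Then $E_q(\mathcal C)=q^2$ if and only if $\mathcal C$ is defined over $\mathbb F_q$.
   Context: $\mathrm{PG}(2,q)$ is regarded as canonically embedded in $\mathrm{PG}(2,q^2)$ (the points admitting coordinates in $\mathbb F_q$). A conic is the zero set of a quadratic form $F\in\mathbb F_{q^2}[X_0,X_1,X_2]$; it is irreducible if $F$ is absolutely irreducible, and it is defined over $\mathbb F_q$ if $F$ is a scalar multiple of a form with coefficients in $\mathbb F_q$. A point of $\mathrm{PG}(2,q^2)$ not on $\mathcal C$ is external to $\mathcal C$ if it lies on two tangent lines to $\mathcal C$ and internal if it lies on none. $E_q(\mathcal C)$ denotes the number of points of $\mathrm{PG}(2,q)$ which are external to $\mathcal C$. *)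

(* Defs.v *)
From HB Require Import structures.
From mathcomp Require Import all_boot all_order all_algebra all_field.
Set Implicit Arguments. Unset Strict Implicit. Unset Printing Implicit Defensive.
Import GRing.Theory.
Local Open Scope ring_scope.

(* PG(2,q^2) is modelled over a finite field F with #|F| = q^2.
   Vectors of F^3 are row vectors 'rV[F]_3.  A projective point (and, dually,
   a projective line) is represented by its unique normalized representative:
   a nonzero vector whose first nonzero coordinate is 1. *)

Definition odd_prime_power (q : nat) : Prop :=
  exists p k : nat, [/\ prime p, odd p, (0 < k)%N & q = (p ^ k)%N].

Section PG.
Variable F : finFieldType.

Definition Fq (q : nat) : pred F := fun x => x ^+ q == x.

Definition normalized (v : 'rV[F]_3) : bool :=
  [exists i : 'I_3, (v 0 i == 1) && [forall j : 'I_3, (j < i)%N ==> (v 0 j == 0)]].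

Definition incident (P l : 'rV[F]_3) : bool := \sum_(i < 3) P 0 i * l 0 i == 0.

Definition inPGq (q : nat) (v : 'rV[F]_3) : bool :=
  [exists k : F, (k != 0) && [forall i : 'I_3, Fq q (k * v 0 i)]].

(* A quadratic form  sum_{i <= j} c_ij X_i X_j  is given by its coefficients
   c i j for i <= j (entries of c below the diagonal are ignored). *)
Definition qform (c : 'M[F]_3) (v : 'rV[F]_3) : F :=
  \sum_(i < 3) \sum_(j < 3 | (i <= j)%N) c i j * v 0 i * v 0 j.

(* the form is nonzero and is absolutely irreducible: over no extension
   field L of F is it a product of two linear forms sum a_i X_i, sum b_i X_i *)
Definition abs_irreducible (c : 'M[F]_3) : Prop :=
  (exists i j : 'I_3, (i <= j)%N /\ c i j != 0) /\
  forall (L : fieldType) (f : {rmorphism F -> L}) (a b : 'I_3 -> L),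
    ~ (forall i j : 'I_3, (i <= j)%N ->
         f (c i j) = if i == j then a i * b i else a i * b j + a j * b i).

Definition defined_over_Fq (q : nat) (c : 'M[F]_3) : Prop :=
  exists (lam : F) (d : 'M[F]_3),
    (forall i j : 'I_3, (i <= j)%N -> Fq q (d i j)) /\
    (forall i j : 'I_3, (i <= j)%N -> c i j = lam * d i j).

Definition on_conic (c : 'M[F]_3) (v : 'rV[F]_3) : bool := qform c v == 0.

Definition tangent (c : 'M[F]_3) (l : 'rV[F]_3) : bool :=
  #|[set P : 'rV[F]_3 | [&& normalized P, incident P l & on_conic c P]]| == 1%N.

Definition external (c : 'M[F]_3) (P : 'rV[F]_3) : bool :=
  ~~ on_conic c P &&
  (#|[set l : 'rV[F]_3 | [&& normalized l, incident P l & tangent c l]]| == 2%N).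

Definition Eq (q : nat) (c : 'M[F]_3) : nat :=
  #|[set P : 'rV[F]_3 | [&& normalized P, inPGq q P & external c P]]|.

End PG.

(* Main.v *)
Require Import Defs.
From HB Require Import structures.
From mathcomp Require Import all_boot all_order all_algebra all_field.
From mathcomp Require Import cyclic ring zify.
Set Implicit Arguments. Unset Strict Implicit. Unset Printing Implicit Defensive.
Import Order.TTheory GRing.Theory Num.Theory.

(** Let Q be the quadratic form of the conic, A its Gram matrix and chi the quadratic
    character of F_(q^2).  Counting the tangents through P with the dual form shows that P
    is external iff chi (- det A * Q(P)) = 1.  Move the given rational point to (0, 0, 1)
    by an element of GL_3(q); then Q(x, y, z) = beta(x, y) z + gamma(x, y) is affine in z.
    Since chi = 1 on F_q^*, averaging over translates gives the sum of chi (z + d) over z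
    in F_q as -1 for every d outside F_q.  Hence the sum of chi (Q(x, y, z)) over z in F_q
    has absolute value 1 unless the binary cubic beta^q gamma - beta gamma^q (with
    coefficients conjugated) vanishes at (x, y).  If this cubic is nonzero it has at most
    3 (q - 1) nonzero zeros in F_q^2, so the sum of chi (Q) over F_q^3 is at most
    (q - 1) (4 q - 2) in absolute value, whereas q^2 external points would force at least
    q (q - 1)^2, which is larger for q >= 5.  If the cubic vanishes identically, then
    nondegeneracy forces A to be proportional to a matrix over F_q.  Conversely, if
    A = lam D with D over F_q, then - det A * Q(P) is lam^4 times an element of F_q, so
    every rational point off the conic is external. *)


(** * The quadratic character of a finite field *)

Section QuadraticCharacter.
Local Open Scope ring_scope.
Variable F : finFieldType.

Definition is_square (x : F) := [exists y : F, y ^+ 2 == x].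

Definition qchar (x : F) : int :=
  if x == 0 then 0 else if is_square x then 1 else -1.

Lemma expf_card_pred (x : F) : x != 0 -> x ^+ #|F|.-1 = 1.
Proof.
move=> x0; apply: (mulfI x0); rewrite -exprS mulr1.
by rewrite prednK ?expf_card // (ltn_trans _ (finNzRing_gt1 F)).
Qed.

Lemma finField_prim_root : exists z : F, #|F|.-1.-primitive_root z.
Proof.
have F1 := finNzRing_gt1 F.
have /hasP[z _ zP] : has #|F|.-1.-primitive_root [seq x <- enum F | x != 0].
  apply: has_prim_root; rewrite ?filter_uniq //.
  - by rewrite -subn1 subn_gt0.
  - apply/allP => x; rewrite mem_filter => /andP[x0 _].
    by rewrite unity_rootE; apply/eqP/expf_card_pred.
  - by rewrite -enumT enum_uniq.
  - rewrite enumT -(cardC1 (0 : F)) cardE /enum_mem.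
    by apply: eq_leq; congr size; apply: eq_filter.
by exists z.
Qed.

(** The n distinct powers of a primitive n-th root exhaust them; such a root is a power of a
    generator of the multiplicative group. *)
Lemma card_unity_roots (n : nat) : (n %| #|F|.-1)%N -> #|[set x : F | x ^+ n == 1]| = n.
Proof.
have [z zP] := finField_prim_root => nF.
have wP := dvdn_prim_root zP nF; set w := z ^+ _ in wP.
have n0 : (0 < n)%N by apply: dvdn_gt0 nF; apply: prim_order_gt0 zP.
have -> : [set x : F | x ^+ n == 1] = [set w ^+ (i : nat) | i : 'I_n].
  apply/setP => x; rewrite inE; apply/eqP/imsetP => [|[i _ ->]].
    by move=> /(prim_rootP wP)[i ->]; exists i.
  by rewrite exprAC (prim_expr_order wP) expr1n.
rewrite card_imset ?card_ord // => i j /eqP.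
by rewrite (eq_prim_root_expr wP) !modn_small // => /eqP/val_inj.
Qed.

Hypothesis oddF : odd #|F|.

(** Translation by 1 permutes the field, so comparing the sums of x and of x + 1 gives |F| * 1 = 0.
    With |F| odd, 2 = 0 would turn this into 1 = 0. *)
Lemma odd_card_two_neq0 : (2%:R : F) != 0.
Proof.
apply/eqP => two0.
have : (1 : F) *+ #|F| = 0.
  rewrite -sumr_const; apply: (addrI (\sum_(x : F) x)); rewrite addr0 -big_split.
  by rewrite [RHS](reindex_inj (addIr 1)).
rewrite -(odd_double_half #|F|) oddF mulrnDr -muln2 mulnC mulrnA.
by rewrite two0 mul0rn addr0 => /eqP; rewrite oner_eq0.
Qed.

Lemma half_card : #|F|.-1 = (#|F|.-1./2 * 2)%N.
Proof. by have := oddF; have := finNzRing_gt1 F; lia. Qed.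

(** Put m = (|F| - 1)/2. If x = z^i with z a generator and x^m = 1, then 2m divides i m, so i is
    even and z^(i/2) is a square root. *)
Lemma euler_criterion (x : F) : x != 0 -> is_square x = (x ^+ #|F|.-1./2 == 1).
Proof.
move=> x0; apply/existsP/eqP => [[y /eqP yx]|].
  rewrite -yx -exprM mulnC -half_card expf_card_pred //.
  by apply: contraNneq x0 => y0; rewrite -yx y0 expr0n.
have [z zP] := finField_prim_root.
have [i ->] := prim_rootP zP (expf_card_pred x0).
rewrite -exprM => /eqP; rewrite -(prim_order_dvd zP) [X in (X %| _)%N]half_card mulnC.
have m0 : (0 < #|F|.-1./2)%N by have := half_card; have := prim_order_gt0 zP; lia.
rewrite dvdn_pmul2r // => /dvdnP[j ->].
by exists (z ^+ j); rewrite exprM.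
Qed.

Lemma expf_half_card (x : F) : x != 0 -> x ^+ #|F|.-1./2 = 1 \/ x ^+ #|F|.-1./2 = -1.
Proof.
move=> x0; have /eqP := expf_card_pred x0.
by rewrite {1}half_card exprM sqrf_eq1 => /orP[]/eqP->; [left|right].
Qed.

Lemma opp1_neq1 : (-1 : F) == 1 = false.
Proof.
apply/negbTE/eqP => h; have := odd_card_two_neq0.
by rewrite [2%:R]mulr2n -{1}h addNr eqxx.
Qed.

Lemma qcharM (x y : F) : qchar (x * y) = qchar x * qchar y.
Proof.
rewrite /qchar mulf_eq0; have [|x0] := eqVneq x 0; first by rewrite mul0r.
have [|y0] := eqVneq y 0; first by rewrite mulr0.
rewrite /= !euler_criterion ?mulf_neq0 // exprMn.
by case: (expf_half_card x0) => ->; case: (expf_half_card y0) => ->;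
  rewrite ?mulN1r ?opprK ?mulr1 ?mul1r ?eqxx ?opp1_neq1.
Qed.

Lemma qchar_eq0 (x : F) : (qchar x == 0) = (x == 0).
Proof. by rewrite /qchar; case: (eqVneq x 0) => // _; case: ifP. Qed.

Lemma qchar1 : qchar 1 = 1.
Proof.
rewrite /qchar oner_eq0 ifT //; apply/existsP; exists 1; by rewrite expr1n.
Qed.

Lemma qchar0 : qchar 0 = 0. Proof. by rewrite /qchar eqxx. Qed.

Lemma qchar_cases (x : F) : x != 0 -> qchar x = 1 \/ qchar x = -1.
Proof. by rewrite /qchar => /negbTE->; case: ifP; [left|right]. Qed.

Lemma qchar_sqr (x : F) : x != 0 -> qchar (x ^+ 2) = 1.
Proof. by move=> /qchar_cases; rewrite expr2 qcharM => -[]->. Qed.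

Lemma qcharV (x : F) : qchar x^-1 = qchar x.
Proof.
have [->|x0] := eqVneq x 0; first by rewrite invr0.
have : qchar (x * x^-1) = 1 by rewrite mulfV // qchar1.
by rewrite qcharM; case: (qchar_cases x0) => ->; rewrite ?mul1r // mulN1r => <-; rewrite opprK.
Qed.

Lemma qchar_norm_le1 (x : F) : `|qchar x| <= 1.
Proof. by rewrite /qchar; case: (eqVneq x 0) => // _; case: ifP. Qed.

(** Multiplication by a generator, which is a nonsquare, permutes the field and negates every
    term. *)
Lemma sum_qchar : \sum_x qchar x = 0.
Proof.
have [z zP] := finField_prim_root.
have zm : z ^+ #|F|.-1./2 != 1.
  rewrite -(prim_order_dvd zP); apply/negP => /dvdn_leq.
  by have := half_card; have := prim_order_gt0 zP; lia.
have z0 : z != 0 by apply: contraTneq zP => ->; apply/negP => /prim_expr_order/eqP;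
  rewrite expr0n -subn1 subn_eq0 leqNgt finNzRing_gt1 eq_sym oner_eq0.
have qz : qchar z = -1 by rewrite /qchar (negbTE z0) euler_criterion // (negbTE zm).
have : \sum_x qchar x = - \sum_x qchar x.
  rewrite {1}(reindex_inj (mulfI z0)) -sumrN.
  by apply: eq_bigr => x _; rewrite qcharM qz mulN1r.
lia.
Qed.

End QuadraticCharacter.


(** * Character sums over the subfield of order q *)

(** Packages the q-power map as a ring morphism, so that membership in F_q becomes being fixed by a
    morphism. *)
Lemma exists_frobenius (R : comNzRingType) (p k : nat) : (p \in [pchar R])%R ->
  exists f : {rmorphism R -> R}, forall x, f x = (x ^+ (p ^ k))%R.
Proof.
move=> pR; elim: k => [|k [f fE]]; first by exists idfun => x.
exists (f \o pFrobenius_aut pR : {rmorphism R -> R}) => x.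
by rewrite /= fE pFrobenius_autE -GRing.exprM -expnS.
Qed.

Section Subfield.
Local Open Scope ring_scope.
Variables (F : finFieldType) (q : nat) (f : {rmorphism F -> F}).
Hypotheses (fE : forall x, f x = x ^+ q) (cardF : #|F| = (q ^ 2)%N) (oddq : odd q).

Local Notation K := (@Fq F q).

Lemma FqE x : K x = (f x == x). Proof. by rewrite fE. Qed.

Lemma FqP x : reflect (f x = x) (K x). Proof. by rewrite FqE; apply: eqP. Qed.

Lemma Fq_nat n : K n%:R. Proof. by apply/FqP; rewrite rmorph_nat. Qed.
Lemma FqD x y : K x -> K y -> K (x + y).
Proof. by move=> /FqP hx /FqP hy; apply/FqP; rewrite rmorphD hx hy. Qed.
Lemma FqN x : K x -> K (- x).
Proof. by move=> /FqP hx; apply/FqP; rewrite rmorphN hx. Qed.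
Lemma FqM x y : K x -> K y -> K (x * y).
Proof. by move=> /FqP hx /FqP hy; apply/FqP; rewrite rmorphM hx hy. Qed.
Lemma FqV x : K x -> K x^-1.
Proof. by move=> /FqP hx; apply/FqP; rewrite fmorphV hx. Qed.

Lemma order_gt1 : (1 < q)%N.
Proof. by have := finNzRing_gt1 F; rewrite cardF; case: (q) => [|[]]. Qed.

Lemma card_pred_factor : #|F|.-1 = (q.-1 * q.+1)%N.
Proof. by rewrite cardF; have := order_gt1; case: (q) => // r _; rewrite -mulnn; lia. Qed.

Lemma odd_cardF : odd #|F|. Proof. by rewrite cardF oddX oddq orbT. Qed.

Lemma two_neq0 : (2%:R : F) != 0.
Proof. exact: odd_card_two_neq0 odd_cardF. Qed.

Lemma Fq_unity x : x != 0 -> K x = (x ^+ q.-1 == 1).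
Proof.
move=> x0; rewrite /Fq -(inj_eq (mulfI x0) (x ^+ q.-1)) -exprS mulr1.
by rewrite prednK // ltnW ?order_gt1.
Qed.

(** Apart from 0, the elements are the (q - 1)-th roots of unity, and q - 1 divides q^2 - 1. *)
Lemma card_Fq : #|[pred x : F | K x]| = q.
Proof.
have q1 := order_gt1.
rewrite (cardD1 0) inE /= /Fq expr0n -(prednK (ltnW q1)) /= eqxx add1n.
congr _.+1; rewrite -[RHS](@card_unity_roots F) ?card_pred_factor ?dvdn_mulr //.
rewrite -[LHS]cardsE; congr #|pred_of_set _|; apply/setP => x; rewrite !inE.
case: (eqVneq x 0) => [->|x0] /=.
  by rewrite expr0n -subn1 subn_eq0 leqNgt q1 eq_sym oner_eq0.
by rewrite prednK ?(ltnW q1) //= [LHS](Fq_unity x0).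
Qed.

(** As q + 1 is even, (q^2 - 1)/2 is a multiple of q - 1, so the power in Euler's criterion is 1 on
    K^*. *)
Lemma qchar_Fq x : K x -> x != 0 -> qchar x = 1.
Proof.
move=> Kx x0; rewrite /qchar (negbTE x0) (euler_criterion odd_cardF) //.
have -> : (#|F|.-1./2 = q.-1 * q.+1./2)%N.
  rewrite card_pred_factor; have {1}-> : q.+1 = (q.+1./2 * 2)%N by move: oddq; lia.
  by rewrite mulnA muln2 doubleK.
by move: Kx; rewrite Fq_unity // exprM => /eqP->; rewrite expr1n eqxx.
Qed.

Lemma qchar_FqM k x : K k -> k != 0 -> qchar (k * x) = qchar x.
Proof. by move=> Kk k0; rewrite (qcharM odd_cardF) (qchar_Fq Kk k0) mul1r. Qed.

Lemma FqMl k x : K k -> k != 0 -> K (k * x) = K x.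
Proof.
move=> Kk k0; apply/idP/idP => [Kkx|]; last exact: FqM.
by rewrite -(mulKf k0 x) FqM // FqV.
Qed.

(* F is the disjoint union of K and the sets t (K + d), t in K^*; chi sums to 0 over F,
   equals 1 on K^*, and has the same sum over all the t (K + d). *)
Lemma sum_qchar_coset d : ~~ K d -> \sum_(s | K s) qchar (s + d) = -1.
Proof.
move=> Kd; set X := LHS; have q1 := order_gt1; have K0 : K 0 := Fq_nat 0.
pose g (u : F * F) := u.1 + u.2 * d.
pose KK := [set u : F * F | K u.1 && K u.2].
have KKE : KK = setX [set x | K x] [set x | K x] by apply/setP => u; rewrite !inE.
have cKK : #|KK| = (q ^ 2)%N by rewrite KKE cardsX cardsE card_Fq mulnn.
have ginj : {in KK &, injective g}.
  move=> [a b] [a' b']; rewrite !inE /g /= => /andP[Ka Kb] /andP[Ka' Kb'] e.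
  have [bb|bb] := eqVneq b b'; first by move: e; rewrite bb => /addIr->.
  have bb0 : b - b' != 0 by rewrite subr_eq0.
  case/negP: Kd; suff -> : d = (b - b')^-1 * (a' - a).
    by rewrite FqM ?FqV ?FqD ?FqN.
  apply: (mulfI bb0); rewrite mulVKf // mulrBl.
  by apply/eqP; rewrite subr_eq addrAC -e; apply/eqP; ring.
have gT : g @: KK = setT.
  by apply/eqP; rewrite eqEcard subsetT card_in_imset // cKK cardsT cardF leqnn.
have := sum_qchar odd_cardF.
have -> : \sum_(x : F) qchar x = \sum_(x in g @: KK) qchar x.
  by apply: eq_bigl => x; rewrite gT inE.
rewrite big_imset //= big_mkcond /=.
have -> : \sum_i (if i \in KK then qchar (g i) else 0)
    = \sum_a \sum_b (if (a, b) \in KK then qchar (g (a, b)) else 0).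
  by rewrite pair_bigA; apply: eq_bigr => -[a b].
rewrite exchange_big (bigD1 0) //=.
have -> : \sum_a (if (a, 0) \in KK then qchar (g (a, 0)) else 0) = q.-1%:Z.
  rewrite (bigD1 0) //= /g /= mul0r addr0 qchar0 if_same add0r.
  transitivity (\sum_(a | K a && (a != 0)) (1 : int)).
    rewrite [LHS]big_mkcond [RHS]big_mkcond; apply: eq_bigr => a _.
    rewrite inE /= addr0 K0 andbT.
    have [->|a0] /= := eqVneq a 0; first by rewrite andbF.
    by rewrite andbT; case: ifP => // Ka; rewrite qchar_Fq.
  rewrite sumr_const -[in RHS]card_Fq [in RHS](cardD1 0) inE /= K0.
  by rewrite add1n /= natz; congr (Posz _); apply: eq_card => a; rewrite !inE andbC.
have -> : \sum_(b | b != 0) \sum_a (if (a, b) \in KK then qchar (g (a, b)) else 0)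
    = \sum_(b | K b && (b != 0)) X.
  rewrite [LHS]big_mkcond [RHS]big_mkcond; apply: eq_bigr => b _.
  have [->|b0] /= := eqVneq b 0; first by rewrite andbF.
  rewrite andbT; case: ifP => Kb; last by apply: big1 => a _; rewrite inE /= Kb andbF.
  rewrite (reindex_inj (mulfI b0)) /X [RHS]big_mkcond; apply: eq_bigr => a _.
  by rewrite inE /= Kb andbT FqMl // /g /= -mulrDr qchar_FqM.
rewrite sumr_const.
have -> : #|(fun b => K b && (b != 0))| = q.-1.
  rewrite -[in RHS]card_Fq [in RHS](cardD1 0) inE /= K0.
  by rewrite add1n /=; apply: eq_card => a; rewrite !inE andbC.
(* The vanishing total now reads (q - 1)(1 + X) = 0. *)
rewrite -mulr_natr natz -[X in X + _]mul1r -mulrDl => /eqP.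
rewrite mulf_eq0 addrC addr_eq0 => /orP[/eqP//|/eqP[]].
by move: q1; clear; lia.
Qed.

(** Factoring out b leaves the sum over the translate by c / b, and the hypothesis says exactly that
    c / b lies outside K. *)
Lemma sum_qchar_affine (b c : F) : b * f c != c * f b ->
  `|\sum_(s | K s) qchar (b * s + c)| = 1.
Proof.
move=> bc; have b0 : b != 0 by apply: contraNneq bc => ->; rewrite rmorph0 mul0r mulr0.
have Kd : ~~ K (c / b).
  apply: contraNN bc => /FqP; rewrite rmorphM fmorphV => e.
  have fb0 : f b != 0 by rewrite fmorph_eq0.
  by move/eqP: e; rewrite eqr_div // mulrC.
rewrite (eq_bigr (fun s => qchar b * qchar (s + c / b))); last first.
  by move=> s _; rewrite -(qcharM odd_cardF); congr qchar; field.
rewrite -mulr_sumr sum_qchar_coset //.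
by case: (qchar_cases b0) => ->.
Qed.

End Subfield.


(** * Ternary quadratic forms *)

Section ThreeByThree.
Local Open Scope ring_scope.

Definition i0 : 'I_3 := @Ordinal 3 0 isT.
Definition i1 : 'I_3 := @Ordinal 3 1 isT.
Definition i2 : 'I_3 := @Ordinal 3 2 isT.

Lemma ord3P (P : 'I_3 -> Prop) : P i0 -> P i1 -> P i2 -> forall i, P i.
Proof.
move=> p0 p1 p2 [[|[|[|//]]] hi].
- by rewrite (_ : Ordinal hi = i0) //; apply: val_inj.
- by rewrite (_ : Ordinal hi = i1) //; apply: val_inj.
- by rewrite (_ : Ordinal hi = i2) //; apply: val_inj.
Qed.

Lemma sum_ord3 (V : nmodType) (g : 'I_3 -> V) : \sum_i g i = g i0 + g i1 + g i2.
Proof.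
rewrite !big_ord_recl big_ord0 addr0 addrA.
by congr (g _ + g _ + g _); apply: val_inj.
Qed.

Definition row3 (R : nzRingType) (x y z : R) : 'rV[R]_3 := \row_i [:: x; y; z]`_i.

Lemma row3E (R : nzRingType) (x y z : R) :
  (row3 x y z 0 i0 = x) * (row3 x y z 0 i1 = y) * (row3 x y z 0 i2 = z).
Proof. by rewrite !mxE. Qed.

Lemma row3_eta (R : nzRingType) (v : 'rV[R]_3) : v = row3 (v 0 i0) (v 0 i1) (v 0 i2).
Proof. by apply/rowP; apply: ord3P; rewrite row3E. Qed.

Lemma row3_eq (R : nzRingType) (v w : 'rV[R]_3) :
  v 0 i0 = w 0 i0 -> v 0 i1 = w 0 i1 -> v 0 i2 = w 0 i2 -> v = w.
Proof. by move=> e0 e1 e2; rewrite [v]row3_eta [w]row3_eta e0 e1 e2. Qed.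

Lemma big_row3 (R : finNzRingType) (V : nmodType) (g : 'rV[R]_3 -> V) :
  \sum_v g v = \sum_x \sum_y \sum_z g (row3 x y z).
Proof.
rewrite pair_bigA (pair_bigA _ (fun u z => g (row3 u.1 u.2 z))) /=.
rewrite (reindex (fun u : R * R * R => row3 u.1.1 u.1.2 u.2)) //=.
exists (fun v => (v 0 i0, v 0 i1, v 0 i2)) => [[[x y] z] _|v _] /=.
  by rewrite !row3E.
by rewrite [RHS]row3_eta.
Qed.

Variable R : comNzRingType.
Implicit Type A : 'M[R]_3.

Lemma det2 (A : 'M[R]_2) : \det A = A 0 0 * A 1 1 - A 0 1 * A 1 0.
Proof.
rewrite (expand_det_row _ 0) !big_ord_recl big_ord0 /cofactor.
rewrite !det_mx11 !mxE /= addr0 expr0 mul1r expr1 mulN1r mulrN.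
by congr (A _ _ * A _ _ - A _ _ * A _ _); apply: val_inj.
Qed.

(** Makes entries depend only on the numeric value of the index, so that the ordinals produced by
    cofactor expansion reduce to a common form. *)
Lemma matrix_natE A : A = \matrix_(i, j) A (inord i) (inord j).
Proof. by apply/matrixP => i j; rewrite mxE !inord_val. Qed.

Lemma det3 A : \det A =
  A i0 i0 * (A i1 i1 * A i2 i2 - A i1 i2 * A i2 i1)
  - A i0 i1 * (A i1 i0 * A i2 i2 - A i1 i2 * A i2 i0)
  + A i0 i2 * (A i1 i0 * A i2 i1 - A i1 i1 * A i2 i0).
Proof.
rewrite [A]matrix_natE (expand_det_row _ 0) !big_ord_recl big_ord0.
rewrite /cofactor !det2 !mxE /= /bump /= !addn0 ?addn1 ?add0n expr0 expr1 addr0.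
ring.
Qed.

Lemma adj3_22 A : \adj A i2 i2 = A i0 i0 * A i1 i1 - A i0 i1 * A i1 i0.
Proof.
rewrite [A]matrix_natE !mxE /cofactor det2 !mxE /= /bump /=.
by rewrite -signr_odd /= expr0 mul1r.
Qed.

Definition qf A (v : 'rV[R]_3) : R := (v *m A *m v^T) 0 0.

Lemma qf_mul A (N : 'M[R]_3) v : qf A (v *m N) = qf (N *m A *m N^T) v.
Proof. by rewrite /qf trmx_mul !mulmxA. Qed.

Lemma qfZ A k v : qf A (k *: v) = k ^+ 2 * qf A v.
Proof. by rewrite /qf -!scalemxAl linearZ /= -scalemxAr scalerA mxE. Qed.

Lemma qf0 A : qf A 0 = 0.
Proof. by rewrite /qf !mul0mx mxE. Qed.

Lemma qf3 A v : A^T = A -> qf A v =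
  A i0 i0 * v 0 i0 ^+ 2 + 2%:R * A i0 i1 * v 0 i0 * v 0 i1 + A i1 i1 * v 0 i1 ^+ 2
  + 2%:R * (A i0 i2 * v 0 i0 + A i1 i2 * v 0 i1) * v 0 i2 + A i2 i2 * v 0 i2 ^+ 2.
Proof.
move=> AT; have As i j : A i j = A j i by rewrite -{1}AT mxE.
rewrite /qf mxE sum_ord3 !mxE !sum_ord3 (As i1 i0) (As i2 i0) (As i2 i1).
ring.
Qed.

Lemma tr_congr A (N : 'M[R]_3) : A^T = A -> (N *m A *m N^T)^T = N *m A *m N^T.
Proof. by move=> AT; rewrite !trmx_mul trmxK AT mulmxA. Qed.

End ThreeByThree.

(** * Completing a vector to an invertible matrix *)

Section Completion.
Local Open Scope ring_scope.
Variable F : fieldType.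

(** The added rows are unit vectors, so any field endomorphism fixing P fixes N. A rational point is
    thus moved to (0, 0, 1) by a rational matrix. *)
Lemma row_completion (P : 'rV[F]_3) : P != 0 ->
  exists N : 'M[F]_3, [/\ N \in unitmx, row i2 N = P &
    forall f : {rmorphism F -> F}, map_mx f P = P -> map_mx f N = N].
Proof.
move=> P0.
pose mk (u v : 'rV[F]_3) : 'M[F]_3 := \matrix_(i, j) [:: u 0 j; v 0 j; P 0 j]`_i.
have mkrow u v : row i2 (mk u v) = P by apply/rowP => j; rewrite !mxE.
have mkf u v (f : {rmorphism F -> F}) : map_mx f u = u -> map_mx f v = v ->
    map_mx f P = P -> map_mx f (mk u v) = mk u v.
  move=> /rowP fu /rowP fv /rowP fP; apply/matrixP => i j; move: i; apply: ord3P; rewrite !mxE /=;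
  [have := fu j|have := fv j|have := fP j]; by rewrite !mxE.
(* Unit vectors are written with booleans cast to F, so that every morphism visibly fixes them. *)
have frow3 (f : {rmorphism F -> F}) (a b c : bool) :
   map_mx f (row3 a%:R b%:R c%:R) = row3 a%:R b%:R c%:R.
  by apply: row3_eq; rewrite !mxE /= rmorph_nat.
have mkdet u v : \det (mk u v) =
  P 0 i0 * (u 0 i1 * v 0 i2 - u 0 i2 * v 0 i1) - P 0 i1 * (u 0 i0 * v 0 i2 - u 0 i2 * v 0 i0)
  + P 0 i2 * (u 0 i0 * v 0 i1 - u 0 i1 * v 0 i0).
  by rewrite det3 !mxE /=; ring.
(* The two unit vectors avoid a coordinate where P is nonzero; the determinant is that coordinate up
   to sign. *)
have [p2|p2] := eqVneq (P 0 i2) 0; last first.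
  exists (mk (row3 true%:R false%:R false%:R)
      (row3 false%:R true%:R false%:R));
    split => // [|f fP]; last exact: mkf.
  by rewrite unitmxE mkdet !row3E unitfE /=
    !(mulr0, mul0r, subr0, sub0r, mulr1, oppr0, addr0, add0r).
have [p1|p1] := eqVneq (P 0 i1) 0; last first.
  exists (mk (row3 true%:R false%:R false%:R)
      (row3 false%:R false%:R true%:R));
    split => // [|f fP]; last exact: mkf.
  by rewrite unitmxE mkdet !row3E unitfE /=
    !(mulr0, mul0r, subr0, sub0r, mulr1, oppr0, addr0, add0r) oppr_eq0.
have p0 : P 0 i0 != 0.
  by apply: contraNneq P0 => p0; apply/eqP/row3_eq; rewrite mxE.
exists (mk (row3 false%:R true%:R false%:R)
      (row3 false%:R false%:R true%:R));
    split => // [|f fP]; last exact: mkf.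
by rewrite unitmxE mkdet !row3E unitfE /=
    !(mulr0, mul0r, subr0, sub0r, mulr1, oppr0, addr0, add0r).
Qed.

End Completion.


(** * Counting points on conics and lines *)

Section Projective.
Local Open Scope ring_scope.
Variable F : finFieldType.
Implicit Types (P v l : 'rV[F]_3) (A : 'M[F]_3).

Lemma normalizedP v :
  reflect (exists i : 'I_3, v 0 i = 1 /\ forall j : 'I_3, (j < i)%N -> v 0 j = 0)
  (normalized v).
Proof.
apply: (iffP existsP) => -[i].
  by move=> /andP[/eqP vi /forallP h]; exists i; split => // j ji; have := h j; rewrite ji => /eqP.
move=> [vi h]; exists i; rewrite vi eqxx; apply/forallP => j; apply/implyP => ji.
by rewrite h.
Qed.

Lemma normalized_neq0 v : normalized v -> v != 0.
Proof.
move=> /normalizedP[i [vi _]]; apply/eqP => v0.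
by move/eqP: vi; rewrite v0 mxE eq_sym oner_eq0.
Qed.

(** Both sides have the same leading position, and their leading entries are a and b. *)
Lemma normalized_scale_inj (a b : F) v w : a != 0 -> b != 0 -> normalized v -> normalized w ->
  a *: v = b *: w -> a = b /\ v = w.
Proof.
move=> a0 b0 /normalizedP[i [vi hv]] /normalizedP[j [wj hw]] e.
have ek k : a * v 0 k = b * w 0 k by move/rowP: e => /(_ k); rewrite !mxE.
have ij : i = j.
  apply: val_inj => /=; case: (ltngtP i j) => // h.
    by have := ek i; rewrite vi (hw _ h) mulr1 mulr0 => /eqP; rewrite (negbTE a0).
  by have := ek j; rewrite wj (hv _ h) mulr1 mulr0 => /eqP; rewrite eq_sym (negbTE b0).
have ab : a = b by have := ek i; rewrite vi ij wj !mulr1.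
by split=> //; move: e; rewrite ab => /(scalerI b0).
Qed.

Lemma exists_normalized v : v != 0 -> exists i, v 0 i != 0 /\ normalized ((v 0 i)^-1 *: v).
Proof.
move=> v0; have [k vk] : exists k, v 0 k != 0.
  apply/existsP; apply: contraNT v0; rewrite negb_exists => /forallP h.
  by apply/eqP/rowP => j; rewrite mxE; apply/eqP; have := h j; rewrite negbK.
case: (@arg_minnP _ k (fun k => v 0 k != 0) (@nat_of_ord 3) vk) => i vi hi.
exists i; split=> //; apply/normalizedP; exists i; rewrite mxE mulVf //; split=> // j ji.
rewrite mxE; apply/eqP; rewrite mulf_eq0 orbC; apply: contraTT ji.
by rewrite negb_or -leqNgt => /andP[vj _]; apply: hi.
Qed.

(** Each vector of the cone is uniquely a scalar times a normalized vector. The predicate [L] allows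
    the same count over F and over F_q. *)
Lemma card_cone (L : pred F) (Q : pred 'rV[F]_3) :
  (forall x y, L x -> L y -> L (x * y)) -> (forall x, L x -> L x^-1) ->
  (forall k v, k != 0 -> Q (k *: v) = Q v) -> ~~ Q 0 ->
  #|[set v : 'rV[F]_3 | Q v && [forall i, L (v 0 i)]]| =
  (#|[set k : F | L k && (k != 0%R)]| *
   #|[set v : 'rV[F]_3 | [&& normalized v, Q v & [forall i, L (v 0%R i)]]]|)%N.
Proof.
move=> LM LV QZ Q0; set S := [set k | _]; set T := [set v | [&& _, _ & _]].
rewrite -cardsX -(@card_in_imset _ _ (fun u : F * 'rV[F]_3 => u.1 *: u.2)); last first.
  move=> [a v] [b w]; rewrite !inE /= => /andP[/andP[_ a0] /and3P[nv _ _]]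
    /andP[/andP[_ b0] /and3P[nw _ _]] e.
  by have [-> ->] := normalized_scale_inj a0 b0 nv nw e.
congr #|pred_of_set _|; apply/setP => v; rewrite inE; apply/andP/imsetP => [[Qv /forallP Lv]|].
  have v0 : v != 0 by apply: contraTneq Qv => ->.
  have [i [vi nv]] := exists_normalized v0.
  exists (v 0 i, (v 0 i)^-1 *: v); rewrite ?inE /=; last by rewrite scalerA mulfV // scale1r.
  rewrite Lv vi nv QZ ?invr_eq0 // Qv /=; apply/forallP => j.
  by rewrite mxE LM // LV.
move=> [[k w]]; rewrite !inE /= => /andP[/andP[Lk k0] /and3P[nw Qw /forallP Lw]] ->.
by rewrite QZ // Qw; split=> //; apply/forallP => i; rewrite mxE LM.
Qed.

Lemma card_cone_all (Q : pred 'rV[F]_3) :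
  (forall k v, k != 0 -> Q (k *: v) = Q v) -> ~~ Q 0 ->
  #|[set v | Q v]| = (#|F|.-1 * #|[set v | normalized v && Q v]|)%N.
Proof.
move=> QZ Q0; have := @card_cone predT Q (fun _ _ _ _ => isT) (fun _ _ => isT) QZ Q0.
have -> : #|[set k : F | predT k && (k != 0)]| = #|F|.-1.
  by rewrite -(cardC1 (0 : F)) cardsE; apply: eq_card => x; rewrite !inE.
have fT v : [forall i : 'I_3, predT (v 0 i)] by apply/forallP.
set B := [set v | Q v && _]; have -> : B = [set v | Q v].
  by apply/setP => v; rewrite !inE fT andbT.
by move=> ->; congr (_ * #|pred_of_set _|)%N; apply/setP => v; rewrite !inE fT andbT.
Qed.

Hypothesis oddF : odd #|F|.
Let two0 : (2%:R : F) != 0 := odd_card_two_neq0 oddF.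

Lemma card_sqrt (d : F) : #|[set x : F | x ^+ 2 == d]|%:Z = 1 + qchar d.
Proof.
rewrite /qchar; have [->|d0] := eqVneq d 0.
  rewrite (_ : [set x : F | _] = [set 0]) ?cards1 //.
  by apply/setP => x; rewrite !inE sqrf_eq0.
case: ifP => [/existsP[y /eqP yd]|/existsP nd].
  have y0 : y != 0 by apply: contraNneq d0 => y0; rewrite -yd y0 expr0n.
  rewrite (_ : [set x : F | _] = [set y; - y]).
    rewrite cards2 -addr_eq0 -mulr2n -mulr_natl mulf_eq0 negb_or two0 y0 //.
  by apply/setP => x; rewrite !inE -yd eqf_sqr.
rewrite (_ : [set x : F | _] = set0) ?cards0 //.
by apply/setP => x; rewrite !inE; apply/negP => e; case: nd; exists x.
Qed.

Lemma card_pair (P : F -> F -> bool) :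
  #|[set u : F * F | P u.1 u.2]| = (\sum_y #|[set x | P x y]|)%N.
Proof.
rewrite -sum1_card big_mkcond (eq_bigr (fun u => (P u.1 u.2 : nat))); last first.
  by move=> u _; rewrite inE; case: (P _ _).
rewrite -(pair_bigA _ (fun x y => (P x y : nat))) exchange_big; apply: eq_bigr => y _.
by rewrite -sum1_card [RHS]big_mkcond; apply: eq_bigr => x _; rewrite inE; case: (P _ _).
Qed.

(** For a != 0, completing the square gives 1 + chi(b^2 - ac) values of x for each y != 0, and none
    for y = 0. For a = 0, all of y = 0 vanishes and the remaining linear factor gives one x for each
    y != 0 if b != 0, none otherwise. *)
Lemma card_binary_form (a b c : F) : (a, b, c) != (0, 0, 0) ->
  #|[set u : F * F | (u != (0, 0)) && (a * u.1 ^+ 2 + 2%:R * b * u.1 * u.2 + c * u.2 ^+ 2 == 0)]|%:Z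
  = #|F|.-1%:Z * (1 + qchar (b ^+ 2 - a * c)).
Proof.
move=> abc.
pose P (x y : F) := ((x, y) != (0, 0)) && (a * x ^+ 2 + 2%:R * b * x * y + c * y ^+ 2 == 0).
rewrite (_ : [set u | _] = [set u | P u.1 u.2]); last by apply/setP => -[x y]; rewrite !inE.
have PE0 x : P x 0 = (x != 0) && (a == 0).
  rewrite /P xpair_eqE eqxx andbT mulr0 expr0n mulr0 !addr0.
  by have [->|x0] //= := eqVneq x 0; rewrite mulf_eq0 expf_eq0 /= (negbTE x0) orbF.
have sum_const (n : int) : \sum_(y : F | y != 0) n = #|F|.-1%:Z * n.
  rewrite sumr_const -mulr_natl natz; congr (_%:Z * _).
  by rewrite -(cardC1 (0 : F)); apply: eq_card => x; rewrite !inE.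
rewrite card_pair (big_morph Posz PoszD (erefl : Posz 0 = 0)) (bigD1 0) //=.
have [a0|a0] := eqVneq a 0; last first.
  rewrite (_ : [set x | P x 0] = set0) ?cards0 ?add0r; last first.
    by apply/setP => x; rewrite !inE PE0 (negbTE a0) andbF.
  rewrite -sum_const; apply: eq_bigr => y y0; rewrite -card_sqrt; congr Posz.
  (* The substitution t = (a x + b y) / y turns the equation into t^2 = b^2 - a c. *)
  have inj : injective (fun x => (a * x + b * y) / y).
    by move=> x x' /(mulIf (invr_neq0 y0))/addIr/(mulfI a0).
  rewrite -[LHS](card_imset _ inj); congr #|pred_of_set _|; apply/setP => t.
  apply/imsetP/idP => [[x]|]; last rewrite inE => /eqP td.
    rewrite !inE /P => /andP[_ /eqP e] ->.
     rewrite -subr_eq0 (_ : _ - _ = a / y ^+ 2 * (a * x ^+ 2 + 2%:R * b * x * y + c * y ^+ 2)).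
      by rewrite e mulr0.
    by field.
  exists ((t - b) * y / a); last by field; rewrite y0 a0.
  rewrite inE /P xpair_eqE (negbTE y0) andbF /=.
  rewrite (_ : _ + _ = y ^+ 2 / a * (t ^+ 2 - (b ^+ 2 - a * c))); last by field.
  by rewrite td subrr mulr0.
rewrite a0 mul0r subr0.
have -> : #|[set x | P x 0]| = #|F|.-1.
  rewrite (_ : [set x | P x 0] = [set~ 0]) ?cardsC1 //.
  by apply/setP => x; rewrite !inE PE0 a0 eqxx andbT.
have PE x y : y != 0 -> P x y = (2%:R * b * x + c * y == 0).
  move=> y0; rewrite /P xpair_eqE (negbTE y0) andbF a0 mul0r add0r /=.
  by rewrite expr2 mulrA -mulrDl mulf_eq0 (negbTE y0) orbF.
have [b0|b0] := eqVneq b 0.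
  rewrite b0 expr0n qchar0 big1 ?addr0 ?mulr1 // => y y0; congr Posz.
  apply/eqP; rewrite cards_eq0; apply/eqP/setP => x; rewrite !inE PE // b0 mulr0 mul0r add0r.
  apply/negbTE; rewrite mulf_neq0 //; apply: contraNneq abc => c0.
  by rewrite a0 b0 c0.
rewrite (qchar_sqr oddF) // mulrDr mulr1; congr (_ + _); rewrite -[RHS]mulr1 -sum_const.
apply: eq_bigr => y y0; rewrite (_ : [set x | _] = [set - (c * y) / (2%:R * b)]) ?cards1 //.
have b20 : 2%:R * b != 0 by rewrite mulf_neq0.
apply/setP => x; rewrite !inE PE // addr_eq0; apply/eqP/eqP => [e|->].
  by rewrite -e mulrC mulKf.
by rewrite mulrC divfK.
Qed.

Lemma incidentE P l : incident P l = ((P *m l^T) 0 0 == 0).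
Proof. by rewrite /incident mxE; congr (_ == 0); apply: eq_bigr => i _; rewrite mxE. Qed.

(** After moving the line to z = 0, the form restricts to a binary form. Its discriminant is minus a
    cofactor of the new matrix B, that is - det B times the last diagonal entry of B^-1, which is
    the dual form at l. Passing from det B to det A costs a square. *)
Lemma card_conic_line A l : A^T = A -> A \in unitmx -> l != 0 ->
  #|[set P : 'rV[F]_3 | [&& normalized P, incident P l & qf A P == 0]]|%:Z
  = 1 + qchar (- \det A * qf (invmx A) l).
Proof.
move=> AT Au l0.
have [N [Nu Nl _]] := row_completion l0.
(* Points transform by the inverse transpose of the matrix used for lines, so v M lies on l iff the
   last coordinate of v is 0. *)
pose M := invmx N^T; have Mu : M \in unitmx by rewrite unitmx_inv unitmx_tr.
pose B := M *m A *m M^T; have BT : B^T = B by apply: tr_congr.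
have Bu : B \in unitmx by rewrite !unitmx_mul Mu Au unitmx_tr.
have Ml : M *m l^T = (row i2 1%:M)^T 
  by rewrite -Nl -[in LHS](mul1mx N) row_mul trmx_mul /M mulKmx // unitmx_tr.
have F1 : #|F|.-1%:Z != 0 by rewrite -lt0n -subn1 subn_gt0 finNzRing_gt1.
(* Both sides are multiplied by |F| - 1 in order to count vectors instead of points. *)
apply: (mulfI F1); pose Q v := [&& v != 0, incident v l & qf A v == 0].
have QZ k v : k != 0 -> Q (k *: v) = Q v.
  move=> k0; rewrite /Q scaler_eq0 (negbTE k0) /= qfZ mulf_eq0 sqrf_eq0 (negbTE k0) /=.
  by rewrite !incidentE -scalemxAl mxE mulf_eq0 (negbTE k0).
rewrite (_ : [set P | _] = [set v | normalized v && Q v]); last first.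
  apply/setP => v; rewrite !inE /Q; case nv: (normalized v) => //=.
  by rewrite normalized_neq0.
rewrite -PoszM -card_cone_all //; last by rewrite /Q eqxx.
have MI : injective (fun v : 'rV[F]_3 => v *m M).
  by apply: (can_inj (g := fun v => v *m invmx M)) => v; rewrite mulmxK.
pose h (u : F * F) := row3 u.1 u.2 0 *m M.
have hI : injective h 
  by move=> [x y] [x' y'] /MI e; congr (_, _);
    [have := congr1 (fun v => v 0 i0) e|have := congr1 (fun v => v 0 i1) e]; rewrite !row3E.
have Minc v : incident (v *m M) l = (v 0 i2 == 0).
  rewrite incidentE -mulmxA Ml; congr (_ == 0).
  by rewrite mxE sum_ord3 !mxE /= !mulr0 !add0r mulr1.
rewrite (_ : [set v | Q v] = h @: [set u : F * F | (u != (0, 0)) &&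
   (B i0 i0 * u.1 ^+ 2 + 2%:R * B i0 i1 * u.1 * u.2 + B i1 i1 * u.2 ^+ 2 == 0)]); last first.
  apply/setP => v; rewrite inE -[v](mulmxKV Mu); set w := v *m invmx M.
  rewrite /Q Minc qf_mul -/B qf3 //.
  apply/and3P/imsetP => [[w0 /eqP w2 /eqP e]|[[x y]]].
    exists (w 0 i0, w 0 i1); last by rewrite /h /= -w2 -row3_eta.
    rewrite inE /=; apply/andP; split; last by rewrite -e w2; apply/eqP; ring.
    apply: contraNneq w0 => -[w00 w01]; apply/eqP.
    by rewrite [w]row3_eta w00 w01 w2 (_ : row3 0 0 0 = 0) ?mul0mx //;
      apply: row3_eq; rewrite row3E mxE.
  rewrite inE /= => /andP[u0 /eqP e] /MI we; rewrite we !row3E; split => //.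
    apply: contraNneq u0 => /(congr1 (mulmx^~ (invmx M))); rewrite mulmxK // mul0mx => e0.
    by apply/eqP; congr (_, _); 
      [have := congr1 (fun v => v 0 i0) e0|have := congr1 (fun v => v 0 i1) e0];
      rewrite row3E mxE.
  by rewrite /= -[X in _ == X]e; apply/eqP; ring.
have Bs : B i1 i0 = B i0 i1 by rewrite -[in LHS]BT mxE.
rewrite (card_imset _ hI) card_binary_form; last first.
  apply: contraTneq Bu => -[a0 b0 c0]; rewrite unitmxE det3 Bs a0 b0 c0.
  by rewrite !(mul0r, mulr0, subrr, subr0, addr0) unitr0.
congr (_ * (1 + _)).
have dM : \det M != 0 by rewrite -unitfE -unitmxE.
have dA : \det A != 0 by rewrite -unitfE -unitmxE.
have BV : N *m invmx A *m N^T = invmx B.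
  apply: (can_inj (mulKmx Bu)); rewrite mulmxV // /B /M trmx_inv trmxK !mulmxA.
  by rewrite mulmxKV // mulmxK // mulVmx ?unitmx_tr.
have -> : qf (invmx A) l = (invmx B) i2 i2.
  by rewrite -Nl -[N]mul1mx row_mul qf_mul BV /qf
    -row_mul mul1mx !mxE sum_ord3 !mxE /= !mulr0 !add0r mulr1.
have -> : (invmx B) i2 i2 = (\det B)^-1 * (B i0 i0 * B i1 i1 - B i0 i1 ^+ 2).
  by rewrite /invmx Bu expr2 -{2}Bs -adj3_22 mxE.
rewrite {1}/B !det_mulmx det_tr -[LHS](mulr1) -(qchar_sqr oddF (invr_neq0 dM)).
rewrite -(qcharM oddF); congr qchar; rewrite -/B; field.
by rewrite dA dM.
Qed.

End Projective.


(** * Counting in coordinates with (0, 0, 1) on the conic *)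

Section Core.
Local Open Scope ring_scope.
Variables (F : finFieldType) (q : nat) (f : {rmorphism F -> F}).
Hypotheses (fE : forall x, f x = x ^+ q) (cardF : #|F| = (q ^ 2)%N) (oddq : odd q).
Local Notation K := (@Fq F q).
Local Notation KP := (FqP fE _).

Definition Fq_vec (v : 'rV[F]_3) := [forall i, K (v 0 i)].

Lemma Fq_vecE v : Fq_vec v = [&& K (v 0 i0), K (v 0 i1) & K (v 0 i2)].
Proof.
apply/forallP/and3P => [h|[h0 h1 h2]]; first by split.
exact: ord3P.
Qed.

Lemma big_Fq_vec (V : nmodType) (g : 'rV[F]_3 -> V) :
  \sum_(v | Fq_vec v) g v = \sum_(y | K y) \sum_(x | K x) \sum_(z | K z) g (row3 x y z).
Proof.
rewrite big_mkcond big_row3 [RHS]exchange_big [RHS]big_mkcond; apply: eq_bigr => x _ /=.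
case: ifP => Kx; last first.
  by do 2![apply: big1 => ? _]; rewrite Fq_vecE row3E Kx.
rewrite [RHS]big_mkcond; apply: eq_bigr => y _ /=.
case: ifP => Ky; last by apply: big1 => ? _; rewrite Fq_vecE !row3E Ky andbF.
rewrite [RHS]big_mkcond; apply: eq_bigr => z _ /=.
by rewrite Fq_vecE !row3E Kx Ky.
Qed.

Lemma sum_Fq (n : int) : \sum_(x | K x) n = q%:Z * n.
Proof.
rewrite sumr_const -mulr_natl natz; congr (_%:Z * _).
by rewrite -[RHS](card_Fq cardF oddq).
Qed.

Lemma sum_Fq_neq0 (n : int) : \sum_(x | K x && (x != 0)) n = q.-1%:Z * n.
Proof.
have := sum_Fq n; rewrite (bigD1 0) /=; last exact: (Fq_nat fE 0).
have := order_gt1 cardF; case: (q) => // r _ /=.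
by rewrite intS mulrDl mul1r => /addrI.
Qed.

Lemma sum_indicator (T : finType) (P : pred T) (Q : pred T) :
  \sum_(x | P x) (Q x)%:Z = #|[set x | P x && Q x]|%:Z.
Proof.
rewrite -sum1_card (big_morph Posz PoszD (erefl : Posz 0 = 0)) big_mkcond [RHS]big_mkcond.
by apply: eq_bigr => x _; rewrite inE; case: (P x) => //; case: (Q x).
Qed.

Variable A : 'M[F]_3.
Hypotheses (AT : A^T = A) (A22 : A i2 i2 = 0) (dA : \det A != 0).

Let a := A i0 i0. Let b := A i0 i1. Let c := A i1 i1.
Let u := A i0 i2. Let v := A i1 i2.
Let be x y := 2%:R * (u * x + v * y).
Let ga x y := a * x ^+ 2 + 2%:R * b * x * y + c * y ^+ 2.

Lemma qf_row3 x y z : qf A (row3 x y z) = be x y * z + ga x y.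
Proof. by rewrite qf3 // !row3E A22 /be /ga -/a -/b -/c -/u -/v; ring. Qed.

(** This is - [ga] v (- u): up to sign, the quadratic part evaluated at the zero of the linear
    part. *)
Lemma det_uv : \det A = 2%:R * b * u * v - a * v ^+ 2 - c * u ^+ 2.
Proof.
have As i j : A i j = A j i by rewrite -{1}AT mxE.
rewrite det3 A22 (As i1 i0) (As i2 i0) (As i2 i1) -/a -/b -/c -/u -/v; ring.
Qed.

(** Coefficients of half the cubic [be] * [ga]^f - [ga] * [be]^f, where ^f conjugates coefficients.
    A zero in K^2 marks a pair where [be] and [ga] may be proportional over K. *)
Let k3 := u * f a - a * f u.
Let k2 := 2%:R * u * f b + v * f a - 2%:R * b * f u - a * f v.
Let k1 := u * f c + 2%:R * v * f b - c * f u - 2%:R * b * f v.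
Let k0 := v * f c - c * f v.
Let cub x y := k3 * x ^+ 3 + k2 * x ^+ 2 * y + k1 * x * y ^+ 2 + k0 * y ^+ 3.

Lemma cubE x y : K x -> K y -> be x y * f (ga x y) - ga x y * f (be x y) = 2%:R * cub x y.
Proof.
move=> /KP fx /KP fy.
rewrite /be /ga !(rmorphD, rmorphM, rmorphXn, rmorph_nat) /= fx fy /cub /k3 /k2 /k1 /k0.
ring.
Qed.

(* If the cubic vanishes identically, evaluating it on the kernel (v, - u) of the linear
   form forces u f v = v f u, i.e. the tangent line at the base point is rational. *)
Lemma cub_zero_rational : k3 = 0 -> k2 = 0 -> k1 = 0 -> k0 = 0 ->
  exists (lam : F) (D : 'M[F]_3), map_mx f D = D /\ A = lam *: D.
Proof.
move=> e3 e2 e1 e0.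
have uv : u * f v = v * f u.
  apply: (mulfI dA); apply/eqP; rewrite -subr_eq0 det_uv.
  rewrite (_ : _ - _ = k0 * u ^+ 3 - k1 * v * u ^+ 2 + k2 * v ^+ 2 * u - k3 * v ^+ 3); last first.
    by rewrite /k3 /k2 /k1 /k0; ring.
  by rewrite e3 e2 e1 e0; apply/eqP; ring.
have two0 := two_neq0 cardF oddq.
(* It suffices to find a nonzero lam whose quotient with every entry is fixed by f; whichever of u,
   v is nonzero will do. *)
suff [lam lam0 [ha hb hc [hu hv]]] : exists2 lam, lam != 0 &
   [/\ f a * lam = a * f lam, f b * lam = b * f lam, f c * lam = c * f lam &
    f u * lam = u * f lam /\ f v * lam = v * f lam].
  exists lam, (lam^-1 *: A); split; last by rewrite scalerA mulfV // scale1r.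
  have fl0 : f lam != 0 by rewrite fmorph_eq0.
  have key w : f w * lam = w * f lam -> f (lam^-1 * w) = lam^-1 * w.
    by move=> e; apply/eqP; rewrite rmorphM fmorphV ![_^-1 * _]mulrC eqr_div // e.
  have As i j : A i j = A j i by rewrite -{1}AT mxE.
  apply/matrixP; do 2![apply: ord3P]; rewrite !mxE; apply: key => //;
    rewrite ?[A i1 i0]As ?[A i2 i0]As ?[A i2 i1]As // A22 rmorph0 !mul0r //.
have [u0|u0] := eqVneq u 0.
  have v0 : v != 0.
    by apply: contraNneq dA => v0; rewrite det_uv u0 v0; apply/eqP; ring.
  exists v => //; split; last by split; [rewrite u0 rmorph0 !mul0r | rewrite mulrC].
  - by apply/eqP; rewrite -subr_eq0 -e2 /k2 u0 rmorph0; apply/eqP; ring.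
  - apply: (mulfI two0); apply/eqP; rewrite -subr_eq0 -e1 /k1 u0 rmorph0; apply/eqP; ring.
  - by apply/eqP; rewrite -subr_eq0 -e0 /k0; apply/eqP; ring.
exists u => //.
have ha : f a * u = a * f u by apply/eqP; rewrite -subr_eq0 -e3 /k3; apply/eqP; ring.
have hv : f v * u = v * f u by rewrite mulrC.
split => //.
- apply: (mulfI two0); apply: (mulfI u0); apply/eqP; rewrite -subr_eq0.
  rewrite (_ : _ - _ = u * k2 - v * (f a * u - a * f u) + a * (f v * u - v * f u)); last first.
    by rewrite /k2; ring.
  by rewrite e2 ha hv; apply/eqP; ring.
- have hb : 2%:R * (v * f b - b * f v) * u = 2%:R * (f b * u - b * f u) * v.
    apply/eqP; rewrite -subr_eq0 (_ : _ - _ = - (2%:R * b * (f v * u - v * f u))); last by ring.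
    by rewrite hv; apply/eqP; ring.
  have hbu : 2%:R * (f b * u - b * f u) = 0.
    apply: (mulfI u0).
    rewrite (_ : u * _ = u * k2 - v * (f a * u - a * f u) + a * (f v * u - v * f u)); last first.
      by rewrite /k2; ring.
    by rewrite e2 ha hv; ring.
  apply: (mulfI u0); apply/eqP; rewrite -subr_eq0.
  rewrite (_ : _ - _ = u * k1 - 2%:R * (v * f b - b * f v) * u); last by rewrite /k1; ring.
  by rewrite hb hbu e1; apply/eqP; ring.
- by split; rewrite // mulrC.
Qed.

(** For fixed y != 0 this is a nonzero polynomial in x of degree at most 3, and at most 2 when k3 =
    0. That saving compensates for the row y = 0, which then consists of zeros. *)
Lemma cub_roots (y : F) : (k3, k2, k1, k0) != (0, 0, 0, 0) -> y != 0 ->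
  (#|[set x | K x && (cub x y == 0%R)]| <= 3 - (k3 == 0%R))%N.
Proof.
move=> k y0; pose p := Poly [:: k0 * y ^+ 3; k1 * y ^+ 2; k2 * y; k3].
have pE x : p.[x] = cub x y.
  by rewrite horner_Poly /= /cub; ring.
have p0 : p != 0.
  apply: contraNneq k => p0.
  have pc i : [:: k0 * y ^+ 3; k1 * y ^+ 2; k2 * y; k3]`_i = 0.
    by rewrite -coef_Poly -/p p0 coef0.
  have yn0 n : y ^+ n != 0 by rewrite expf_neq0.
  move: (pc 0) (pc 1) (pc 2) (pc 3) => /= /eqP.
  rewrite mulf_eq0 (negbTE (yn0 3%N)) orbF => /eqP-> /eqP.
  rewrite mulf_eq0 (negbTE (yn0 2%N)) orbF => /eqP-> /eqP.
  by rewrite mulf_eq0 (negbTE y0) orbF => /eqP-> ->.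
have sp : (size p <= 4 - (k3 == 0%R))%N.
  have [e|_] := eqVneq k3 0; last exact: size_Poly.
  apply/leq_sizeP => -[|[|[|j]]] // _; rewrite coef_Poly /= e.
  by case: j => [|[|j]].
have : (size (enum [set x | K x && (cub x y == 0%R)]) < size p)%N.
  apply: max_poly_roots => //; last exact: enum_uniq.
  by apply/allP => x; rewrite mem_enum inE => /andP[_ e]; rewrite rootE pE.
rewrite -cardE; move: sp; lia.
Qed.

Let I x y := \sum_(z | K z) qchar (qf A (row3 x y z)).

Lemma line_sum_le x y : `|I x y| <= q%:Z.
Proof.
apply: le_trans (ler_norm_sum _ _ _) _; rewrite -[leRHS]mulr1 -sum_Fq.
by apply: ler_sum => z _; apply: qchar_norm_le1.
Qed.

Lemma line_sum_base : I 0 0 = 0.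
Proof.
apply: big1 => z _; rewrite qf_row3 /be /ga.
rewrite (_ : _ + _ = 0) ?qchar0 //; ring.
Qed.

Lemma line_sum_generic x y : K x -> K y -> cub x y != 0 -> `|I x y| = 1.
Proof.
move=> Kx Ky cxy; rewrite /I (eq_bigr (fun z => qchar (be x y * z + ga x y))); last first.
  by move=> z _; rewrite qf_row3.
apply: (sum_qchar_affine fE cardF oddq).
by rewrite -subr_eq0 cubE // mulf_neq0 // (two_neq0 cardF).
Qed.

Lemma line_sum_bound x y : K x -> K y -> `|I x y| <= 1 + q.-1%:Z * (cub x y == 0)%:Z.
Proof.
move=> Kx Ky; have [e|ne] := eqVneq (cub x y) 0; last by rewrite line_sum_generic //= mulr0 addr0.
apply: le_trans (line_sum_le x y) _; rewrite mulr1 -intS prednK //.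
exact: ltnW (order_gt1 cardF).
Qed.

(** A line in the z direction contributes at most 1, plus q - 1 more at a zero of the cubic. There
    are at most 3(q - 1) nonzero zeros, and the line over (0, 0) contributes 0. *)
Lemma sum_qchar_bound : (k3, k2, k1, k0) != (0, 0, 0, 0) ->
  `|\sum_(w | Fq_vec w) qchar (qf A w)| <= q.-1%:Z * (q.+1%:Z + 3%:Z * q.-1%:Z).
Proof.
move=> k; rewrite big_Fq_vec -/I.
have K0 : K 0 := Fq_nat fE 0.
have q1 := order_gt1 cardF.
apply: le_trans (ler_norm_sum _ _ _) _.
rewrite (bigD1 0) //=.
(* On y = 0 the cubic is k3 x^3, so its nonzero arguments are all zeros or none is. *)
have row0 : `|\sum_(x | K x) I x 0| <= q.-1%:Z * (1 + q.-1%:Z * (k3 == 0)%:Z).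
  rewrite (bigD1 0) //= line_sum_base add0r; apply: le_trans (ler_norm_sum _ _ _) _.
  rewrite -sum_Fq_neq0; apply: ler_sum => x /andP[Kx x0].
  apply: le_trans (line_sum_bound Kx K0) _; rewrite lerD2l ler_wpM2l //.
  by rewrite /cub !expr0n !mulr0 !addr0 mulf_eq0 expf_eq0 (negbTE x0) andbF orbF.
have rowy y : K y -> y != 0 ->
    `|\sum_(x | K x) I x y| <= q%:Z + q.-1%:Z * (3%:Z - (k3 == 0)%:Z).
  move=> Ky y0; apply: le_trans (ler_norm_sum _ _ _) _.
  apply: le_trans (_ : \sum_(x | K x) (1 + q.-1%:Z * (cub x y == 0)%:Z) <= _).
    by apply: ler_sum => x Kx; apply: line_sum_bound.
  rewrite big_split /= sum_Fq mulr1 lerD2l -mulr_sumr ler_wpM2l // sum_indicator.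
  by have := cub_roots k y0; case: (k3 == 0) => /=; lia.
apply: le_trans (lerD row0 (_ : _ <= q.-1%:Z * (q%:Z + q.-1%:Z * (3%:Z - (k3 == 0)%:Z)))) _.
  by rewrite -sum_Fq_neq0; apply: ler_sum => y /andP[Ky y0]; apply: rowy.
(* Both cases of k3 give the same total. *)
by rewrite -mulrDr ler_wpM2l //; case: (k3 == 0); nia.
Qed.

(** Counts vectors over F_q rather than points, with externality expressed by the quadratic
    character. *)
Definition ext_count := #|[set w | Fq_vec w && (qchar (- \det A * qf A w) == 1)]|.

Definition qzero_count := #|[set w | Fq_vec w && (qf A w == 0)]|.

(** Termwise: chi + 1 - [Q = 0] is 2 if chi = 1 and 0 otherwise. *)
Lemma ext_countE : 2%:Z * ext_count%:Z =
  \sum_(w | Fq_vec w) qchar (- \det A * qf A w) + q%:Z ^+ 3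
  - qzero_count%:Z.
Proof.
have -> : q%:Z ^+ 3 = \sum_(w | Fq_vec w) (1 : int).
  by rewrite big_Fq_vec !sum_Fq; ring.
rewrite /ext_count /qzero_count -!sum_indicator mulr_sumr -big_split -sumrB /=; apply: eq_bigr => w _.
have [->|w0] := eqVneq (qf A w) 0; first by rewrite mulr0 qchar0.
by have [->|->] : qchar (- \det A * qf A w) = 1 \/ qchar (- \det A * qf A w) = -1
  by apply: qchar_cases; rewrite mulf_neq0 // oppr_eq0.
Qed.

Lemma qzero_count_ge : (q <= qzero_count)%N.
Proof.
rewrite /qzero_count.
rewrite -[X in (X <= _)%N](card_Fq cardF oddq).
have inj : injective (fun z : F => row3 0 0 z).
  by move=> z z' /(congr1 (fun w : 'rV_3 => w 0 i2)); rewrite !row3E.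
rewrite -(card_imset _ inj); apply/subset_leq_card/subsetP => w /imsetP[z Kz ->].
have K0 : K 0 := Fq_nat fE 0.
rewrite inE Fq_vecE !row3E K0 /= qf_row3 /be /ga.
by apply/andP; split; [exact: Kz | apply/eqP; ring].
Qed.

Lemma ext_count_defined : (5 <= q)%N -> ext_count = (q.-1 * q ^ 2)%N ->
  exists (lam : F) (D : 'M[F]_3), map_mx f D = D /\ A = lam *: D.
Proof.
move=> q5 e; have [[e3 e2 e1 e0]|k] := eqVneq (k3, k2, k1, k0) (0, 0, 0, 0); first exact: cub_zero_rational.
(* With at least q zeros, the assumed count forces |T| >= 2 q^2 (q - 1) - q^3 + q = q (q - 1)^2.
   This exceeds (q - 1)(4q - 2), since q^2 - 5q + 2 > 0 for q >= 5. *)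
exfalso; have := sum_qchar_bound k; have := ext_countE; have := qzero_count_ge.
have -> : \sum_(w | Fq_vec w) qchar (- \det A * qf A w) =
    qchar (- \det A) * \sum_(w | Fq_vec w) qchar (qf A w).
  by rewrite mulr_sumr; apply: eq_bigr => w _; rewrite (qcharM (odd_cardF cardF oddq)).
set T := \sum_(w | _) _; rewrite e.
have [] : qchar (- \det A) = 1 \/ qchar (- \det A) = -1 by apply: qchar_cases; rewrite oppr_eq0.
  move=> -> ; rewrite mul1r; move: qzero_count T => z T; clear -q5; case: q q5 => // r q5; nia.
move=> -> ; rewrite mulN1r; move: qzero_count T => z T; clear -q5; case: q q5 => // r q5; nia.
Qed.

Lemma sum_Fq_single (P : pred F) t : K t -> (forall x, P x = (x == t)) ->
  \sum_(x | K x) (P x)%:Z = 1.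
Proof.
move=> Kt PE; rewrite (bigD1 t) //= PE eqxx big1 // => x /andP[_ xt].
by rewrite PE (negbTE xt).
Qed.

(** A nontrivial common zero would put a whole line through (0, 0, 1) on the conic. Algebraically,
    det A * x^2 and det A * y^2 are combinations of the linear form and [ga]. *)
Lemma be_ga_zero x y : be x y = 0 -> ga x y = 0 -> (x == 0) && (y == 0).
Proof.
have two0 := two_neq0 cardF oddq.
move=> /eqP; rewrite mulf_eq0 (negbTE two0) => /eqP b0 g0.
have hy : \det A * y ^+ 2 = 0.
  rewrite (_ : _ * _ = (u * x + v * y) * (a * (u * x - v * y) + 2%:R * b * u * y)
    - u ^+ 2 * ga x y).
    by rewrite b0 g0; ring.
  by rewrite det_uv /ga; ring.
have hx : \det A * x ^+ 2 = 0.
  rewrite (_ : _ * _ = (u * x + v * y) * (c * (v * y - u * x) + 2%:R * b * v * x)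
    - v ^+ 2 * ga x y).
    by rewrite b0 g0; ring.
  by rewrite det_uv /ga; ring.
move/eqP: hx; move/eqP: hy; rewrite !mulf_eq0 (negbTE dA) !orbb /=.
by move=> -> ->.
Qed.

(** * Forms proportional to one over F_q *)

Section Rational.
Variables (lam : F) (D : 'M[F]_3).
Hypotheses (Df : map_mx f D = D) (AD : A = lam *: D).

Let KD i j : K (D i j).
Proof. by apply/KP; move/matrixP: Df => /(_ i j); rewrite mxE. Qed.

Let lam0 : lam != 0.
Proof. by apply: contraNneq dA => l0; rewrite AD l0 scale0r det0. Qed.

(** Over (x, y) there is one z in K if the linear form is nonzero there; if it vanishes there is
    none, except that (0, 0) admits all q. The linear form has q zeros in K^2, which gives q^2 - q +
    q. *)
Lemma qzero_count_rational : qzero_count%:Z = q%:Z ^+ 2.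
Proof.
have two0 := two_neq0 cardF oddq.
have K0 : K 0 := Fq_nat fE 0.
rewrite /qzero_count -sum_indicator big_Fq_vec.
have K2 : K 2%:R := Fq_nat fE 2.
have AE i j : A i j = lam * D i j by rewrite AD mxE.
have uE : u = lam * D i0 i2 by rewrite /u AE.
have vE : v = lam * D i1 i2 by rewrite /v AE.
have inner x y : K x -> K y -> \sum_(z | K z) ((qf A (row3 x y z) == 0) : nat)%:Z
    = 1 - (u * x + v * y == 0)%:Z + q%:Z * ((x == 0) && (y == 0))%:Z.
  move=> Kx Ky; have [b0|b0] := eqVneq (u * x + v * y) 0.
    have be0 : be x y = 0 by rewrite /be b0 mulr0.
    rewrite subrr add0r -sum_Fq; apply: eq_bigr => z _.
    rewrite qf_row3 be0 mul0r add0r; congr (_%:Z); congr (nat_of_bool _).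
    apply/eqP/idP => [/(be_ga_zero be0)//|/andP[/eqP-> /eqP->]].
    by rewrite /ga; ring.
  have -> : (x == 0) && (y == 0) = false.
    by apply: contraNF b0 => /andP[/eqP-> /eqP->]; rewrite !mulr0 addr0.
  rewrite mulr0 addr0 subr0.
  have be0 : be x y != 0 by rewrite mulf_neq0.
  apply: (sum_Fq_single (t := - (ga x y / be x y))); last first.
    move=> z; rewrite qf_row3; apply/eqP/eqP => [e|->]; last by field.
    apply: (mulfI be0); rewrite mulrN mulrCA mulfV // mulr1; apply/eqP.
    by rewrite -addr_eq0 e.
  (* The factor lam cancels, so the unique solution z lies in K. *)
  have -> : ga x y / be x y = (D i0 i0 * x ^+ 2 + 2%:R * D i0 i1 * x * y + D i1 i1 * y ^+ 2) /
      (2%:R * (D i0 i2 * x + D i1 i2 * y)).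
    have d0 : D i0 i2 * x + D i1 i2 * y != 0.
      by move: b0; rewrite uE vE -!mulrA -mulrDr mulf_eq0 negb_or => /andP[].
    rewrite /ga /be /a /b /c uE vE !AE; field.
    by rewrite two0 d0 -!mulrA -mulrDr mulf_neq0.
  by rewrite !expr2; do ![exact: KD|exact: K2|exact: Kx|exact: Ky|apply: (FqN fE)
    |apply: (FqM fE)|apply: (FqV fE)|apply: (FqD fE)].
have -> : \sum_(y | K y) \sum_(x | K x) \sum_(z | K z) ((qf A (row3 x y z) == 0) : nat)%:Z
  = \sum_(y | K y) (q%:Z - \sum_(x | K x) ((u * x + v * y == 0) : nat)%:Z + q%:Z * (y == 0)%:Z).
  apply: eq_bigr => y Ky; rewrite (eq_bigr _ (fun x Kx => inner x y Kx Ky)).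
  rewrite big_split sumrB /= sum_Fq mulr1 -mulr_sumr; congr (_ + _ * _).
  have [_|y0] := eqVneq y 0; last by apply: big1 => x _; rewrite andbF.
  by apply: (sum_Fq_single K0) => x; rewrite andbT.
rewrite big_split sumrB /= sum_Fq -mulr_sumr (sum_Fq_single K0) // mulr1.
suff -> : \sum_(y | K y) \sum_(x | K x) ((u * x + v * y == 0) : nat)%:Z = q%:Z by ring.
have [u0|u0] := eqVneq u 0.
  have v0 : v != 0.
    by apply: contraNneq dA => v0; rewrite det_uv u0 v0; apply/eqP; ring.
  rewrite -[RHS]mulr1 -(sum_Fq_single (P := pred1 0) K0) // mulr_sumr.
  apply: eq_bigr => y _; rewrite -sum_Fq; apply: eq_bigr => x _.
  by rewrite u0 mul0r add0r mulf_eq0 (negbTE v0).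
rewrite -[RHS]mulr1 -sum_Fq; apply: eq_bigr => y Ky.
apply: (sum_Fq_single (t := - (v / u * y))).
  have -> : v / u = D i1 i2 / D i0 i2.
    by move: u0; rewrite uE vE mulf_eq0 negb_or => /andP[_ d0]; field; rewrite d0.
  by do ![exact: KD|exact: Ky|apply: (FqN fE)|apply: (FqM fE)|apply: (FqV fE)].
move=> x; apply/eqP/eqP => [e|->]; last by field.
apply: (mulfI u0); rewrite mulrN mulrA mulrCA mulfV // mulr1; apply/eqP.
by rewrite -addr_eq0 e.
Qed.

(** Here - det A * Q(w) is lam^4 times an element of F_q, so chi = 1 at every vector off the conic:
    q^3 - q^2 of them. *)
Lemma ext_count_rational : ext_count = (q.-1 * q ^ 2)%N.
Proof.
have qfA w : qf A w = lam * qf D w by rewrite /qf AD -scalemxAr -scalemxAl mxE.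
have KdD : K (\det D) by apply/KP; rewrite -det_map_mx Df.
have KqD w : Fq_vec w -> K (qf D w).
  move=> /forallP Kw; have wf : map_mx f w = w by apply/rowP => i; rewrite mxE; apply/KP.
  have e : map_mx f (w *m D *m w^T) = w *m D *m w^T by rewrite !map_mxM -map_trmx wf Df.
  by apply/KP; rewrite /qf -[in RHS]e [RHS]mxE.
have dD : \det D != 0 by apply: contraNneq dA => d0; rewrite AD detZ d0 mulr0.
have h : ext_count%:Z = q%:Z ^+ 3 - qzero_count%:Z.
  have -> : q%:Z ^+ 3 = \sum_(w | Fq_vec w) (1 : int).
    by rewrite big_Fq_vec !sum_Fq; ring.
  rewrite /ext_count /qzero_count -!sum_indicator -sumrB; apply: eq_bigr => w Kw.
  have [->|w0] := eqVneq (qf A w) 0; first by rewrite mulr0 qchar0.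
  have wD : qf D w != 0 by apply: contraNneq w0 => d0; rewrite qfA d0 mulr0.
  rewrite (_ : _ * _ = (lam ^+ 2) ^+ 2 * - (\det D * qf D w)); last first.
    by rewrite qfA AD detZ; ring.
  rewrite (qcharM (odd_cardF cardF oddq)) (qchar_sqr (odd_cardF cardF oddq)) ?expf_neq0 //.
  rewrite (qchar_Fq cardF oddq) ?oppr_eq0 ?mulf_neq0 //.
  by apply: (FqN fE); apply: (FqM fE) => //; apply: KqD.
move: h; rewrite qzero_count_rational; have := order_gt1 cardF; clear.
by move: ext_count => e; case: q => // r _; nia.
Qed.

End Rational.

End Core.


(** * External points and the Gram matrix *)

Section Gram.
Local Open Scope ring_scope.
Variable F : finFieldType.
Hypothesis oddF : odd #|F|.
Let two0 : (2%:R : F) != 0 := odd_card_two_neq0 oddF.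

Definition gram (c : 'M[F]_3) : 'M[F]_3 :=
  \matrix_(i, j) (if i == j then c i i else (if (i <= j)%N then c i j else c j i) / 2%:R).

Lemma gram_tr c : (gram c)^T = gram c.
Proof. by apply/matrixP; do 2![apply: ord3P]; rewrite !mxE. Qed.

Lemma qform_gram c v : qform c v = qf (gram c) v.
Proof.
have sumc (i : 'I_3) (g : 'I_3 -> F) : \sum_(j < 3 | (i <= j)%N) g j =
    \sum_(j < 3) (if (i <= j)%N then g j else 0) by exact: big_mkcond.
rewrite qf3 ?gram_tr // /qform sum_ord3 !sumc !sum_ord3 !mxE /=.
by field; rewrite two0.
Qed.

Lemma gram_upper (c : 'M[F]_3) (i j : 'I_3) : (i <= j)%N ->
  c i j = (if i == j then 1 else 2%:R) * gram c i j.
Proof.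
rewrite mxE; have [->|ij] := eqVneq i j; first by rewrite mul1r.
by move=> ->; rewrite mulrC divfK.
Qed.

Lemma exists_sqrt_extension (d : F) :
  exists (L : fieldType) (f : {rmorphism F -> L}) (r : L), r ^+ 2 = f d.
Proof.
have [L [f _]] := countable_algebraic_closure F.
have [r rE] := @solve_monicpoly L 2 (fun i => if i == 0%N then f d else 0) isT.
exists L, f, r; rewrite rE !big_ord_recl big_ord0 /=; ring.
Qed.

(* A degenerate form is congruent to a binary form, which splits once the square root
   of its discriminant is adjoined. *)
Lemma gram_det_neq0 c : abs_irreducible c -> \det (gram c) != 0.
Proof.
move=> [_ irr]; set A := gram c; apply/negP => /det0P[p p0 pA].
have AT : A^T = A := gram_tr c.
have [N [Nu Np _]] := row_completion p0.
pose B := N *m A *m N^T; have BT : B^T = B := tr_congr N AT.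
have Bs i j : B i j = B j i by rewrite -{1}BT mxE.
have B2 j : B i2 j = 0.
  have : row i2 B = 0 by rewrite /B !row_mul Np pA mul0mx.
  by move/rowP/(_ j); rewrite !mxE.
have AB : A = invmx N *m B *m (invmx N)^T.
  by rewrite /B trmx_inv !mulmxA mulVmx // mul1mx mulmxK // unitmx_tr.
clearbody B.
have [L [f [r rE]]] := exists_sqrt_extension (B i0 i1 ^+ 2 - B i0 i0 * B i1 i1).
rewrite rmorphB rmorphXn rmorphM in rE.
have fB0 : f (2%:R) != 0 by rewrite fmorph_eq0.
(* A symmetrized product of two linear forms has twice the Gram matrix. If B00 = 0 one factor is y;
   otherwise they are x + ((b + r)/a) y and a x + (b - r) y, with r^2 = b^2 - a c. *)
have [al [be E]] : exists al be : 'rV[L]_3,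
    map_mx f (2%:R *: B) = al^T *m be + be^T *m al.
  have [a0|a0] := eqVneq (B i0 i0) 0.
    exists (row3 0 1 0), (row3 (2%:R * f (B i0 i1)) (f (B i1 i1)) 0).
    apply/matrixP; do 2![apply: ord3P]; rewrite !mxE !big_ord1 !mxE /=
      ?(Bs i1 i0) ?(Bs i0 i2) ?(Bs i1 i2) ?B2 ?a0 ?rmorphM ?rmorph0 ?rmorph_nat; ring.
  have fa0 : f (B i0 i0) != 0 by rewrite fmorph_eq0.
  exists (row3 1 ((f (B i0 i1) + r) / f (B i0 i0)) 0), (row3 (f (B i0 i0)) (f (B i0 i1) - r) 0).
  apply/matrixP; do 2![apply: ord3P]; rewrite !mxE !big_ord1 !mxE /=
      ?(Bs i1 i0) ?(Bs i0 i2) ?(Bs i1 i2) ?B2 ?rmorphM ?rmorph0 ?rmorph_nat;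
    try (by field); try ring.
  rewrite (_ : _ + _ = 2%:R * (f (B i0 i1) ^+ 2 - r ^+ 2) / f (B i0 i0)); last by field.
  by rewrite rE; field.
pose M := map_mx f (invmx N).
have EA : map_mx f (2%:R *: A) = (al *m M^T)^T *m (be *m M^T) + (be *m M^T)^T *m (al *m M^T).
  rewrite AB scalemxAl scalemxAr !map_mxM E -map_trmx -/M !trmx_mul trmxK.
  by rewrite mulmxDr mulmxDl !mulmxA.
apply: (irr L f (fun i => (al *m M^T) 0 i) (fun i => (be *m M^T) 0 i)) => i j ij.
have e : f (2%:R * A i j) = (al *m M^T) 0 i * (be *m M^T) 0 j + (al *m M^T) 0 j * (be *m M^T) 0 i.
  have := congr1 (fun X : 'M_3 => X i j) EA; rewrite [LHS]mxE [in LHS]mxE => ->.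
  rewrite [LHS]mxE ![(_ *m _ : 'M_3) i j]mxE !big_ord1.
  by rewrite ![(_^T) _ _]mxE [X in _ + X]mulrC.
rewrite (gram_upper c ij) -/A; move: e; have [->|_] := eqVneq i j; last by [].
rewrite mul1r rmorphM => e; apply: (mulfI fB0); rewrite e rmorph_nat; ring.
Qed.

(** The line carries 1 + chi points, hence exactly one iff the argument of chi is 0: tangents are
    the points of the dual conic. *)
Lemma tangentE c l : \det (gram c) != 0 -> normalized l ->
  tangent c l = (qf (invmx (gram c)) l == 0).
Proof.
move=> dA nl; have Au : gram c \in unitmx by rewrite unitmxE unitfE.
have := card_conic_line oddF (gram_tr c) Au (normalized_neq0 nl).
rewrite /tangent.
have -> : [set P : 'rV[F]_3 | [&& normalized P, incident P l & on_conic c P]] =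
    [set P | [&& normalized P, incident P l & qf (gram c) P == 0]].
  by apply/setP => P; rewrite !inE /on_conic qform_gram.
move=> e; rewrite -eqz_nat e -subr_eq0 addrAC subrr add0r qchar_eq0.
by rewrite mulf_eq0 oppr_eq0 (negbTE dA).
Qed.

(** By duality, the tangents through P are counted as the points of the dual conic on the line P.
    Inverting A does not change the character of its determinant. *)
Lemma externalE c P : \det (gram c) != 0 -> normalized P ->
  external c P = (qchar (- \det (gram c) * qf (gram c) P) == 1).
Proof.
move=> dA nP; set A := gram c.
have Au : A \in unitmx by rewrite unitmxE unitfE.
have AVu : invmx A \in unitmx by rewrite unitmx_inv.
have AVT : (invmx A)^T = invmx A by rewrite trmx_inv gram_tr.
have := card_conic_line oddF AVT AVu (normalized_neq0 nP); rewrite invmxK.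
rewrite /external /on_conic qform_gram -/A.
set S := [set l | _]; set S' := [set l | _]; have -> : S' = S.
  apply/setP => l; rewrite !inE; case nl: (normalized l) => //=.
  by rewrite tangentE // /incident; congr ((_ == 0) && _); apply: eq_bigr => i _; rewrite mulrC.
move=> e; rewrite -eqz_nat e.
have -> : qchar (- \det (invmx A) * qf A P) = qchar (- \det A * qf A P).
  by rewrite !(qcharM oddF) det_inv -invrN (qcharV oddF).
have [->|Q0] := eqVneq (qf A P) 0; first by rewrite mulr0 qchar0.
by have [->|->] : qchar (- \det A * qf A P) = 1 \/ qchar (- \det A * qf A P) = -1
  by apply: qchar_cases; rewrite mulf_neq0 // oppr_eq0.
Qed.

End Gram.

(** * From vectors over F_q to points of PG(2,q), and change of coordinates *)

Section Count.
Local Open Scope ring_scope.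
Variables (F : finFieldType) (q : nat) (f : {rmorphism F -> F}).
Hypotheses (fE : forall x, f x = x ^+ q) (cardF : #|F| = (q ^ 2)%N) (oddq : odd q).
Let oddF := odd_cardF cardF oddq.

(** Some coordinate is 1, so a scalar making all coordinates rational is itself in F_q. *)
Lemma inPGq_normalized (v : 'rV[F]_3) : normalized v -> inPGq q v = Fq_vec q v.
Proof.
move=> /normalizedP[i [vi _]]; apply/existsP/forallP => [[k /andP[k0 /forallP h]] j|h].
  have Kk : Fq q k by have := h i; rewrite vi mulr1.
  by rewrite -(mulKf k0 (v 0 j)); apply: (FqM fE) => //; apply: (FqV fE).
by exists 1; rewrite oner_eq0; apply/forallP => j; rewrite mul1r.
Qed.

Lemma Eq_ext_count (c : 'M[F]_3) : \det (gram c) != 0 -> ext_count q (gram c) = (q.-1 * Eq q c)%N.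
Proof.
move=> dA; set A := gram c.
pose Q (v : 'rV[F]_3) := qchar (- \det A * qf A v) == 1.
have QZ k v : k != 0 -> Q (k *: v) = Q v.
  move=> k0; rewrite /Q qfZ mulrCA (qcharM oddF) (qchar_sqr oddF) // mul1r //.
have Q0 : ~~ Q 0 by rewrite /Q qf0 mulr0 qchar0.
have := card_cone (FqM fE) (FqV fE) QZ Q0.
have -> : #|[set k : F | Fq q k && (k != 0)]| = q.-1.
  have := sum_Fq_neq0 fE cardF oddq 1.
  rewrite mulr1 sumr_const natz => -[<-]; rewrite cardsE //.
have -> : [set v | Q v && [forall i, Fq q (v 0 i)]] =
    [set w | Fq_vec q w && (qchar (- \det A * qf A w) == 1)].
  by apply/setP => v; rewrite !inE andbC.
rewrite /ext_count => ->; congr (_ * #|pred_of_set _|)%N; apply/setP => v; rewrite !inE.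
case nv: (normalized v) => //=.
by rewrite inPGq_normalized // externalE // andbC.
Qed.

(** A rational invertible N permutes the rational vectors, and the determinant changes by the square
    of det N. *)
Lemma ext_count_congr (A N : 'M[F]_3) : N \in unitmx -> map_mx f N = N ->
  ext_count q (N *m A *m N^T) = ext_count q A.
Proof.
move=> Nu Nf; rewrite /ext_count.
have dN : \det N != 0 by rewrite -unitfE -unitmxE.
have MI : injective (fun v : 'rV[F]_3 => v *m N).
  by apply: (can_inj (g := fun v => v *m invmx N)) => v; rewrite mulmxK.
have vecE (v : 'rV[F]_3) : Fq_vec q v = (map_mx f v == v).
  apply/forallP/eqP => [h|/rowP h i]; last by apply/(FqP fE); have := h i; rewrite mxE.
  by apply/rowP => i; rewrite mxE; apply/(FqP fE).
rewrite -[LHS](card_imset _ MI); congr #|pred_of_set _|; apply/setP => v.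
have key w : Fq_vec q w && (qchar (- \det (N *m A *m N^T) * qf (N *m A *m N^T) w) == 1) =
   Fq_vec q (w *m N) && (qchar (- \det A * qf A (w *m N)) == 1).
  rewrite !vecE map_mxM Nf (inj_eq MI) qf_mul !det_mulmx det_tr; congr (_ && (_ == 1)).
  rewrite (_ : - _ * _ = (\det N) ^+ 2 * (- \det A * qf (N *m A *m N^T) w)); last by ring.
  by rewrite (qcharM oddF) (qchar_sqr oddF) // mul1r.
rewrite [RHS]inE; apply/imsetP/idP => [[w]|h].
  by rewrite inE key => h ->.
by exists (v *m invmx N); rewrite ?inE ?key mulmxKV.
Qed.

Lemma defined_over_FqP (c : 'M[F]_3) : defined_over_Fq q c <->
  exists (lam : F) (D : 'M[F]_3), map_mx f D = D /\ gram c = lam *: D.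
Proof.
split=> -[lam [D]].
  move=> [KD cD]; exists lam, (gram D); split.
    apply/matrixP; do 2![apply: ord3P]; rewrite !mxE /= ?rmorphM ?fmorphV ?rmorph_nat;
      by rewrite (FqP fE _ (KD _ _ _)).
  apply/matrixP; do 2![apply: ord3P]; rewrite !mxE /= cD // mulrA //.
move=> [Df AD]; have KD i j : Fq q (D i j).
  by apply/(FqP fE); move/matrixP: Df => /(_ i j); rewrite mxE.
exists lam, (\matrix_(i, j) ((if i == j then 1 else 2%:R) * D i j)); split=> i j ij; rewrite mxE.
  by apply: (FqM fE) => //; case: ifP => _; [apply: (Fq_nat fE 1)|apply: (Fq_nat fE 2)].
by rewrite (gram_upper oddF c ij) AD mxE mulrCA.
Qed.

Lemma Eq_iff_defined (c : 'M[F]_3) : (5 <= q)%N -> abs_irreducible c ->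
  (exists P : 'rV[F]_3, [&& normalized P, inPGq q P & on_conic c P]) ->
  (Eq q c = (q ^ 2)%N <-> defined_over_Fq q c).
Proof.
move=> q5 irr [P /and3P[nP KP cP]]; have dA := gram_det_neq0 oddF irr.
have [N [Nu NP Nf]] := row_completion (normalized_neq0 nP).
have Pf : map_mx f P = P.
  rewrite inPGq_normalized // in KP; move/forallP: KP => KP.
  by apply/rowP => i; rewrite mxE; apply/(FqP fE).
have {}Nf := Nf f Pf.
set A := gram c in dA *; pose B := N *m A *m N^T.
have BT : B^T = B := tr_congr N (gram_tr c).
(* The last row of N is P, so this entry is the value of the form at P. *)
have B22 : B i2 i2 = 0.
  rewrite -[RHS](eqP cP) qform_gram // -/A /qf -NP /B -row_mul.
  by rewrite !mxE; apply: eq_bigr => j _; rewrite !mxE.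
have dB : \det B != 0 by rewrite !det_mulmx det_tr !mulf_neq0 // -unitfE -unitmxE.
have eB : ext_count q B = (q.-1 * Eq q c)%N by rewrite ext_count_congr // Eq_ext_count.
have AB : A = invmx N *m B *m (invmx N)^T.
  by rewrite /B trmx_inv !mulmxA mulVmx // mul1mx mulmxK // unitmx_tr.
(* Proportionality to a rational matrix passes between A and B because N and its inverse are fixed
   by f. *)
rewrite defined_over_FqP -/A; split=> [e|[lam [D [Df AD]]]].
  have [lam [D [Df BD]]] := ext_count_defined fE cardF oddq BT B22 dB q5 (etrans eB (congr1 _ e)).
  exists lam, (invmx N *m D *m (invmx N)^T); split.
    by rewrite !map_mxM -map_trmx map_invmx Nf Df.
  by rewrite AB BD -scalemxAr -scalemxAl.
have q1 : (0 < q.-1)%N by rewrite -ltnS prednK (leq_trans _ q5).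
have := @ext_count_rational F q f fE cardF oddq B BT B22 dB lam (N *m D *m N^T).
rewrite eB !map_mxM -map_trmx Nf Df => h; apply/eqP; rewrite -(eqn_pmul2l q1) h //.
by rewrite /B AD -scalemxAr -scalemxAl.
Qed.

End Count.

Theorem theorem1p1 (q : nat) (F : finFieldType) (c : 'M[F]_3) :
  odd_prime_power q -> (5 <= q)%N -> #|F| = (q ^ 2)%N ->
  abs_irreducible c ->
  (exists P : 'rV[F]_3, [&& normalized P, inPGq q P & on_conic c P]) ->
  (Eq q c = (q ^ 2)%N <-> defined_over_Fq q c).
Proof.
move=> [p [k [p_prime p_odd k0 qE]]] q5 cardF.
have oddq : odd q by rewrite qE oddX p_odd orbT.
have pF : p \in [pchar F]%R.
  by apply: (@card_finPcharP _ _ (k * 2)); rewrite // cardF qE expnM.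
have [f fE] := exists_frobenius k pF.
by apply: (@Eq_iff_defined F q f) => // x; rewrite fE qE.
Qed.
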